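(* Let $n,m$ be positive integers. Then there is a nonnegative, measurable function $f$ on $\mathbb{R}$ satisfying $$\sum_{k\in\mathbb{Z}} f(x-kn)=m,\qquad \sum_{k\in\mathbb{Z}} f(x-km)=n\qquad\text{for a.e. } x\in\mathbb{R},$$ with both series converging absolutely for a.e. $x$, and such that $\operatorname{supp} f$ is an interval of length $n+m-\gcd(n,m)$.
   Context: The support of a function $f$ is the set $\operatorname{supp} f=\{x: f(x)\ne 0\}$ (no closure is taken). *)

(* Defs.v *)
From HB Require Import structures.
From mathcomp Require Import all_boot all_order all_algebra.
From mathcomp Require Import all_classical all_reals all_analysis.

Set Implicit Arguments.
Unset Strict Implicit.
Unset Printing Implicit Defensive.

Import Order.TTheory GRing.Theory Num.Theory.
Import numFieldNormedType.Exports.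

Local Open Scope classical_set_scope.
Local Open Scope ring_scope.

(* The booleans [b1] and [b2] choose, independently, whether each endpoint
   belongs to the interval. *)
Definition interval_of_length (R : realType) (L : R) (A : set R) : Prop :=
  exists (a : R) (b1 b2 : bool),
    A = [set` Interval (BSide b1 a) (BSide b2 (a + L))].

Definition supp (R : realType) (f : R -> R) : set R := [set x | f x != 0].

(* The term of index [k] is f (x - k p). [\esum] is the supremum of the finite
   partial sums, so it is the sum of the series when [f] is nonnegative. *)
Definition periodization_eq_ae (R : realType) (f : R -> R) (p c : R) : Prop :=
  {ae @lebesgue_measure R, forall x : R,
    summable [set: int] (fun k : int => (f (x - k%:~R * p))%:E) /\
    (\esum_(k in [set: int]) (f (x - k%:~R * p))%:E = c%:E)%E}.

(* Main.v *)
Require Import Defs.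
From mathcomp Require Import all_boot all_order all_algebra.
From mathcomp Require Import all_classical all_reals all_analysis.
From mathcomp Require Import lra ring.

Import Order.TTheory GRing.Theory Num.Theory.
Import numFieldNormedType.Exports.

Local Open Scope classical_set_scope.
Local Open Scope ring_scope.

(** Write [d = gcd(n, m)], [n = a d] and [m = b d]. The function [f] is [d] times
    the sum of the indicators of the intervals [[(u + v) d, (u + v + 1) d[] for
    [u < a] and [v < b]: a step function whose heights are, up to the factor [d],
    the convolution of the indicators of [{0, .., a-1}] and [{0, .., b-1}]. Summing
    over [u] first shows that [f] is [d] times a sum of [b] translates of the
    indicator of [[0, n[], whose [n]-periodization is [d b = m]; summing over [v]
    first gives the other periodization. The intervals cover
    [[0, (a + b - 1) d[]. *)

Definition box {R : realType} (p x : R) : R := \1_(`[0, p[ : set R) x.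

Lemma boxE {R : realType} (p x : R) : box p x = ((0 <= x) && (x < p))%:R.
Proof. by rewrite /box indicE mem_setE in_itv. Qed.

Lemma box_ge0 {R : realType} (p x : R) : 0 <= box p x.
Proof. by rewrite boxE ler0n. Qed.

Lemma measurable_box {R : realType} (p : R) : measurable_fun [set: R] (box p).
Proof. exact: measurable_realfun.measurable_indic. Qed.

Lemma box_split {R : realType} (d x : R) (a : nat) : 0 < d ->
  box (a%:R * d) x = \sum_(u < a) box d (x - u%:R * d).
Proof.
move=> d_gt0; elim: a => [|a IHa].
  by rewrite big_ord0 boxE mul0r; case: (leP 0 x).
rewrite big_ord_recr /= -IHa !boxE -natr1 mulrDl mul1r.
have : 0 <= a%:R * d by rewrite mulr_ge0 // ltW.
set t := a%:R * d => t_ge0; rewrite subr_ge0 ltrBlDr (addrC d).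
have [x_ge0|x_lt0] := leP 0 x; have [x_ge_t|x_lt_t] := leP t x => /=;
  by rewrite ?addr0 ?add0r //; case: ltP => //; lra.
Qed.

(** The translates of [[0, p[] by multiples of [p] tile the line, so only the index [floor (x / p)]
    contributes. *)
Lemma box_periodization {R : realType} (c p x : R) : 0 <= c -> 0 < p ->
  (\esum_(k in [set: int]) (c * box p (x - k%:~R * p))%:E = c%:E)%E.
Proof.
move=> c_ge0 p_gt0; set k0 := Num.floor (x / p).
have boxk k : box p (x - k%:~R * p) = (k == k0)%:R.
  rewrite boxE subr_ge0 ltrBlDr; congr (_ : bool)%:R.
  have -> : p + k%:~R * p = (k + 1)%:~R * p by rewrite intrD; ring.
  rewrite -ler_pdivlMr // -ltr_pdivrMr //.
  by apply/idP/eqP => [/floor_def // | ->]; exact: floor_itv.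
rewrite -(@esum_set1 R int k0 (fun=> c%:E)) ?lee_fin // [RHS]esum_mkcond.
by apply: eq_esum => k _; rewrite boxk in_set1; case: eqP => _; rewrite ?mulr1 ?mulr0.
Qed.

(** For [p = a d] this is the double sum over [u] and [v] with the sum over [u] already absorbed
    into [box p]. *)
Definition staircase {R : realType} (d p : R) (b : nat) (x : R) : R :=
  d * \sum_(v < b) box p (x - v%:R * d).

(** Cutting each box into cells of length [d] turns both sides into the same double sum. This
    symmetry lets one periodization lemma serve both periods. *)
Lemma staircaseC {R : realType} (d : R) (a b : nat) : 0 < d ->
  staircase d (a%:R * d) b = staircase d (b%:R * d) a.
Proof.
move=> d_gt0; apply/funext => x; congr (_ * _).
under eq_bigr do rewrite box_split //.
rewrite exchange_big /=; apply: eq_bigr => u _; rewrite box_split //.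
by apply: eq_bigr => v _; congr box; ring.
Qed.

Lemma staircase_ge0 {R : realType} (d p : R) (b : nat) (x : R) : 0 < d ->
  0 <= staircase d p b x.
Proof.
move=> d_gt0; apply: mulr_ge0; first exact: ltW.
by apply: sumr_ge0 => v _; exact: box_ge0.
Qed.

Lemma measurable_staircase {R : realType} (d p : R) (b : nat) :
  measurable_fun [set: R] (staircase d p b).
Proof.
apply: measurable_realfun.measurable_funM => //; apply: measurable_sum => v.
by apply: measurableT_comp; [exact: measurable_box | exact: measurable_realfun.measurable_funB].
Qed.

Lemma staircase_periodization {R : realType} (d p : R) (b : nat) :
  0 < d -> 0 < p -> periodization_eq_ae (staircase d p b) p (b%:R * d).
Proof.
move=> d_gt0 p_gt0; apply: aeW => x.
have esumE : (\esum_(k in [set: int]) (staircase d p b (x - k%:~R * p))%:E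
    = (b%:R * d)%:E)%E.
  under eq_esum => k _.
    rewrite /staircase mulr_sumr -sumEFin.
    over.
  rewrite esum_sum; last first.
    by move=> k v _ _; rewrite lee_fin mulr_ge0 ?box_ge0// ltW.
  transitivity (\sum_(v < b) d%:E)%E.
    apply: eq_bigr => v _.
    (* Each translate is periodized at the point [x - v d], and contributes [d] whatever that point
       is. *)
    under eq_esum => k _ do rewrite addrAC.
    by rewrite box_periodization // ltW.
  by rewrite sumEFin sumr_const card_ord mulr_natl.
split=> //; rewrite /summable.
under eq_esum => k _ do rewrite gee0_abs ?lee_fin ?staircase_ge0//.
by rewrite esumE ltry.
Qed.

(** Nonnegative terms cannot cancel, so the support is the union of the translated boxes. Their left
    ends are [d] apart and [d <= p], so no gap is left; the last one starts at [b d]. *)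
Lemma supp_staircase {R : realType} (d p : R) (b : nat) : 0 < d -> d <= p ->
  supp (staircase d p b.+1) = `[0, b%:R * d + p[%classic.
Proof.
move=> d_gt0 le_dp.
apply/seteqP; split => x; rewrite /supp /= in_itv /=.
  rewrite /staircase mulf_eq0 gt_eqF //= psumr_neq0 => [|v _]; last exact: box_ge0.
  case/hasP => v _; rewrite boxE ltr0n lt0b subr_ge0 ltrBlDr.
  case/andP => _ /andP[x_ge x_lt]; apply/andP; split.
    by apply: le_trans x_ge; rewrite mulr_ge0 // ltW.
  apply: lt_le_trans x_lt _.
  by rewrite addrC lerD2r ler_pM2r // ler_nat -ltnS ltn_ord.
move=> /andP[x_ge0 x_lt].
rewrite /staircase mulf_eq0 gt_eqF //= psumr_neq0 => [|v _]; last exact: box_ge0.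
suff [v le_vb /andP[vx xv]] : exists2 v, (v <= b)%N & v%:R * d <= x < v%:R * d + p.
  apply/hasP; exists (inord v); rewrite ?mem_index_enum // boxE ltr0n lt0b.
  by rewrite inordK // subr_ge0 vx ltrBlDr addrC xv.
(* Either [x] lies in the last box, or [x < b.+1 d <= b d + p] and the earlier boxes cover it. *)
elim: b x_lt => [|b IHb] x_lt; first by exists 0%N; rewrite // mul0r x_ge0 -(mul0r d).
have [bx|xb] := leP (b.+1%:R * d) x; first by exists b.+1; rewrite // bx.
have [|v le_vb vx] := IHb; last by exists v; rewrite // ltnW.
by apply: lt_le_trans xb _; rewrite -natr1 mulrDl mul1r lerD2l.
Qed.

Theorem theorem2p10 (R : realType) (n m : nat) (hn : (0 < n)%N) (hm : (0 < m)%N) :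
  exists f : R -> R,
    (forall x : R, 0 <= f x) /\
    measurable_fun [set: R] f /\
    periodization_eq_ae f n%:R m%:R /\
    periodization_eq_ae f m%:R n%:R /\
    interval_of_length (n%:R + m%:R - (gcdn n m)%:R) (supp f).
Proof.
have gcd_gt0 : (0 < gcdn n m)%N by rewrite gcdn_gt0 hn.
have /dvdnP[a n_eq] := dvdn_gcdl n m.
have /dvdnP[b m_eq] := dvdn_gcdr n m.
have b_gt0 : (0 < b)%N by move: hm; rewrite m_eq muln_gt0 => /andP[].
pose d : R := (gcdn n m)%:R.
have d_gt0 : 0 < d by rewrite ltr0n.
have n_eqR : n%:R = a%:R * d by rewrite {1}n_eq natrM.
have m_eqR : m%:R = b%:R * d by rewrite {1}m_eq natrM.
exists (staircase d n%:R b); split; [|split; [|split; [|split]]].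
- by move=> x; exact: staircase_ge0.
- exact: measurable_staircase.
- by rewrite m_eqR; apply: staircase_periodization; rewrite // ltr0n.
- rewrite n_eqR staircaseC // -m_eqR.
  by apply: staircase_periodization; rewrite // ltr0n.
- exists 0, true, true.
  rewrite -(prednK b_gt0) supp_staircase //; last first.
    by rewrite ler_nat dvdn_leq // dvdn_gcdl.
  (* The last box starts at [(b - 1) d = m - d], hence the length [n + m - d]. *)
  have -> : m%:R = b.-1%:R * d + d by rewrite m_eqR -{1}(prednK b_gt0) -natr1; ring.
  by rewrite add0r addrA addrK addrC.
Qed.
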